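(* There is an absolute constant $C>0$ such that the following holds for every positive integer $n$. Let $R_K>2$ be a real number and let $K\subset\mathbb{E}^n$ be a $1$-separated set of diameter at most $R_K-1$. Suppose that $C_K$ is a nonnegative integer such that for every point $q\in K$ there are at most $C_K$ other points of $K$ at distance $<5$ from $q$, and suppose that $$|K|\ \ge\ C\,n^6\,\log R_K\,\max\{5^n, C_K\}.$$ Then $\mathbb{E}^n\not\to(\ell_2,K)$.
   Context: $\mathbb{E}^n$ denotes $\mathbb{R}^n$ with the Euclidean norm. A set is $t$-separated if all pairs of distinct points of it are at distance at least $t$. $\ell_m$ denotes a collection of $m$ points on a line with consecutive points at distance $1$; in particular $\ell_2$ is a pair of points at distance $1$. We write $\mathbb{E}^n\to(S_1,S_2)$ if every coloring of the points of $\mathbb{E}^n$ with two colors $1,2$ contains a congruent copy of $S_i$ all of whose points have color $i$, for some $i\in\{1,2\}$. We write $\mathbb{E}^n\not\to(S_1,S_2)$ if this fails, i.e. if there is a two-coloring (red = color 1, blue = color 2) of $\mathbb{E}^n$ with no all-red congruent copy of $S_1$ and no all-blue congruent copy of $S_2$. Logarithms are natural. *)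

(* Defs.v *)
From mathcomp Require Import all_boot all_order all_algebra.
From mathcomp Require Import all_classical all_reals all_analysis.

Set Implicit Arguments.
Unset Strict Implicit.
Unset Printing Implicit Defensive.

Import Order.TTheory GRing.Theory Num.Theory.
Local Open Scope classical_set_scope.
Local Open Scope ring_scope.

(* E^n is the set of row vectors 'rV[R]_n with the distance below; the norm
   `|x| that the library puts on 'rV[R]_n is the sup norm and is not used. *)
Definition eucl_dist (R : realType) (n : nat) (x y : 'rV[R]_n) : R :=
  Num.sqrt (\sum_(i < n) (x 0 i - y 0 i) ^+ 2).

Definition t_separated (R : realType) (n : nat) (t : R) (K : set 'rV[R]_n) :
    Prop :=
  forall x y, K x -> K y -> x <> y -> t <= eucl_dist x y.

Definition diameter (R : realType) (n : nat) (K : set 'rV[R]_n) : \bar R :=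
  ereal_sup [set (eucl_dist x y)%:E | x in K & y in K].

Definition congruent (R : realType) (n : nat) (S T : set 'rV[R]_n) : Prop :=
  exists2 f : 'rV[R]_n -> 'rV[R]_n,
    forall x y, eucl_dist (f x) (f y) = eucl_dist x y & T = f @` S.

(* The points 0, e, 2e, ..., (m-1)e, with e the first vector of the standard
   basis.  They are m points at consecutive distance 1 only when 0 < n. *)
Definition ell (R : realType) (n m : nat) : set 'rV[R]_n :=
  [set i%:R *: (\row_(j < n) (j == 0 :> nat)%:R) | i in `I_m].
Arguments ell : clear implicits.

(* E^n -> (S1, S2); red (color 1) is true and blue (color 2) is false. *)
Definition arrows (R : realType) (n : nat) (S1 S2 : set 'rV[R]_n) : Prop :=
  forall color : 'rV[R]_n -> bool,
    (exists2 T, congruent S1 T & forall x, T x -> color x = true) \/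
    (exists2 T, congruent S2 T & forall x, T x -> color x = false).

(* Main.v *)
Require Import Defs.
From mathcomp Require Import all_boot all_order all_algebra.
From mathcomp Require Import finmap.
From mathcomp Require Import all_classical all_reals all_analysis.
From mathcomp Require Import ring lra zify.

Set Implicit Arguments.
Unset Strict Implicit.
Unset Printing Implicit Defensive.

Import Order.TTheory GRing.Theory Num.Theory.
Local Open Scope classical_set_scope.
Local Open Scope ring_scope.

(** The coloring is periodic under L Z^n, with L an integer slightly larger than
    RK.  Its red set is a union of open balls of radius 1/2 whose centers form a
    finite set U modulo L Z^n and are pairwise at distance at least 2.  Two
    points of one ball are at distance less than 1, and two points of different
    balls at distance more than 1, so no red pair is at distance 1.  What has to
    be arranged is that every congruent copy of K meets a red ball.

    Up to a small error and modulo L Z^n there are only finitely many copies of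
    K: an isometry is affine, so it is determined by the n(n+1) coordinates of
    one image and of a linear part, and rounding these gives at most RK^(28 n^3)
    classes ([isometry_net], [code_count_le]).  It suffices that for one copy
    per class some point lies within 1/2 - eps of U.

    The centers are chosen one at a time among the points of a fine grid, by a
    derandomized form of random sequential packing ([hard_core_cover]).  A point
    of a copy is alive while no center is within 5/2 of it.  A site within 1/2
    of an alive point is then at distance at least 2 from all centers, so it may
    be added and would cover the copy.  Give an uncovered copy with m alive
    points the weight exp(-theta m).  A site kills at most CK + 1 points of a
    copy, because points within 5/2 of one site are at mutual distance less than
    5; and the balls of radius 1/2 around the points of a copy are disjoint
    because K is 1-separated.  Averaged over the sites that can be added, the
    weight lost by covering therefore outweighs the weight gained by killing, as
    soon as theta is at most a constant times the inverse of both CK + 1 and the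
    ratio of the numbers of sites in balls of radius 5/2 and 1/2 - eps.  With
    eps of order 1/n this ratio is at most 4 * 5^n ([sites_near_card],
    [expansion_ratio]), hence the maximum of 5^n and CK in the hypothesis.  The
    initial total weight is the number of classes times exp(-theta |K|), which
    is below 1 by the lower bound on |K|.  As long as the total weight is below
    1, an uncovered copy still has alive points, so the process goes on until
    every copy is covered. *)

(** * Sequential packing with an exponential potential *)

Lemma expR_le1D2x (R : realType) (x : R) :
  0 <= x -> x <= 1 / 2 -> expR x <= 1 + 2 * x.
Proof.
move=> x0 x2.
have := expR_ge1Dx (- x); rewrite expRN => h.
have e0 := expR_gt0 x.
have : (1 - x) * expR x <= 1.
  by rewrite -ler_pdivlMr// mul1r.
nra.
Qed.

(** [I] indexes the copies, [Q] the points of a copy and [G] the sites;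
    [near i q u] means that a ball at [u] covers the point [q] of copy [i], and
    [kill i q u] that [u] is so close to it that a ball covering the point need
    not fit beside the ball at [u]. *)
Definition alive (G I Q : finType) (kill : I -> Q -> pred G) (U : {set G}) i :=
  [set q | [forall u in U, ~~ kill i q u]]%SET.

Definition covered (G I Q : finType) (near : I -> Q -> pred G) (U : {set G}) i :=
  [exists u in U, [exists q, near i q u]].

Lemma aliveU1 (G I Q : finType) (kill : I -> Q -> pred G) (U : {set G}) i u :
  alive kill (u |: U)%SET i = (alive kill U i :\: [set q | kill i q u])%SET.
Proof.
apply/setP => q; rewrite !inE; apply/forall_inP/andP.
  move=> h; split; first by apply: h; rewrite !inE eqxx.
  by apply/forall_inP => v vU; apply: h; rewrite !inE vU orbT.
case=> hu /forall_inP h v; rewrite !inE => /orP[/eqP->//|]; exact: h.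
Qed.

Lemma coveredU1 (G I Q : finType) (near : I -> Q -> pred G) (U : {set G}) i u :
  covered near (u |: U)%SET i = covered near U i || [exists q, near i q u].
Proof.
apply/exists_inP/orP.
  move=> [v]; rewrite !inE => /orP[/eqP->|vU] h; first by right.
  by left; apply/exists_inP; exists v.
case=> [/exists_inP[v vU h]|h]; first by exists v; rewrite // !inE vU orbT.
by exists u; rewrite // !inE eqxx.
Qed.

Definition weight (R : realType) (G I Q : finType) (near kill : I -> Q -> pred G)
    (theta : R) (U : {set G}) i : R :=
  if covered near U i then 0 else expR (- (theta * #|alive kill U i|%:R)).

Definition addable (G : finType) (sep : rel G) (U : {set G}) : {set G} :=
  [set u | (u \notin U) && [forall v in U, sep u v]]%SET.

(** This is where killing is used: sites near an alive point conflict with no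
    chosen site, so they stay available. *)
Lemma near_addable (G I Q : finType) (near kill : I -> Q -> pred G)
    (sep : rel G) (U : {set G}) i q u :
  (forall i q u v, near i q u -> ~~ kill i q v -> sep u v) ->
  ~~ covered near U i -> q \in alive kill U i -> near i q u ->
  u \in addable sep U.
Proof.
move=> nsep ncov; rewrite !inE => /forall_inP qal nu; apply/andP; split.
  apply: contra ncov => uU; apply/exists_inP; exists u => //.
  by apply/existsP; exists q.
by apply/forall_inP => v vU; apply: (nsep i q) => //; exact: qal.
Qed.

(** A site that kills [y] alive points multiplies the weight of a copy by
    [expR (theta * y) <= 1 + 2 * theta * y], and one that covers the copy brings
    it to 0.  Over all sites the numbers [y] add up to at most [beta] times the
    number of covering sites, since the sites near different points are
    different; [2 * theta * beta <= 1] makes the loss at least the gain. *)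
Lemma sum_weight_step (R : realType) (G I Q : finType)
    (near kill : I -> Q -> pred G) (sep : rel G) (a : nat) (beta theta : R)
    (U : {set G}) i :
  0 <= theta -> theta * a%:R <= 1 / 2 -> 2 * theta * beta <= 1 ->
  (forall i q, #|kill i q|%:R <= beta * #|near i q|%:R) ->
  (forall i u, (#|[set q | kill i q u]%SET| <= a)%N) ->
  (forall i q q' u, near i q u -> near i q' u -> q = q') ->
  (forall i q u v, near i q u -> ~~ kill i q v -> sep u v) ->
  \sum_(u in addable sep U) weight near kill theta (u |: U)%SET i <=
  #|addable sep U|%:R * weight near kill theta U i.
Proof.
move=> th0 tha thb Hkn Ha Hinj Hsep.
have [cov|ncov] := boolP (covered near U i).
  rewrite {2}/weight cov mulr0 big1// => u _.
  by rewrite /weight coveredU1 cov.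
set A := alive kill U i; set S := addable sep U.
pose hit u := [exists q, near i q u].
pose y u := #|(A :&: [set q | kill i q u])%SET|.
have wU : weight near kill theta U i = expR (- (theta * #|A|%:R)).
  by rewrite /weight (negbTE ncov).
set W := weight near kill theta U i in wU *.
have W0 : 0 < W by rewrite wU expR_gt0.
have step u : weight near kill theta (u |: U)%SET i <=
    W * (1 + 2 * theta * (y u)%:R - (hit u)%:R).
  rewrite /weight coveredU1 (negbTE ncov) orFb -/(hit u); case: (hit u) => /=.
    rewrite addrAC subrr add0r; apply: mulr_ge0; first exact: ltW.
    by rewrite !mulr_ge0.
  rewrite subr0 wU aliveU1 -/A cardsD natrB; last first.
    by apply: subset_leq_card; apply: subsetIl.
  rewrite mulrBr opprB -/(y u) addrC expRD ler_wpM2l ?expR_ge0// -mulrA.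
  apply: expR_le1D2x; first by rewrite mulr_ge0.
  apply: le_trans tha; rewrite ler_wpM2l// ler_nat; apply: leq_trans (Ha i u).
  by apply: subset_leq_card; apply: subsetIr.
apply: le_trans (ler_sum _ (fun u _ => step u)) _.
rewrite -mulr_sumr mulrC ler_wpM2r ?(ltW W0)//.
rewrite big_split big_split /= sumr_const sumrN -addrA gerDl subr_le0.
(* Double counting of the pairs of an alive point and a site killing it. *)
have sumy : \sum_(u in S) 2 * theta * (y u)%:R <=
    2 * theta * \sum_(q in A) #|kill i q|%:R.
  rewrite -mulr_sumr ler_wpM2l ?mulr_ge0// -!natr_sum ler_nat.
  apply: (@leq_trans (\sum_u y u)).
    by rewrite [X in (_ <= X)%N](bigID (mem S)) /= leq_addr.
  have -> : (\sum_u y u = \sum_u \sum_(q in A) kill i q u)%N.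
    apply: eq_bigr => u _; rewrite /y -sum1dep_card -big_mkcondr /=.
    by apply: eq_bigl => q; rewrite !inE.
  rewrite exchange_big /=; apply: leq_sum => q _.
  by rewrite -big_mkcond /= sum1_card.
apply: (le_trans sumy).
(* Sites near distinct points are distinct, so covering sites are counted once. *)
have sumhit : \sum_(q in A) #|near i q|%:R <= \sum_(u in S) (hit u)%:R :> R.
  rewrite -!natr_sum ler_nat.
  have -> : (\sum_(q in A) #|near i q| = \sum_u \sum_(q in A) near i q u)%N.
    rewrite exchange_big /=; apply: eq_bigr => q _.
    by rewrite -[RHS]big_mkcond /= sum1_card.
  rewrite [X in (_ <= X)%N]big_mkcond /=; apply: leq_sum => u _.
  have [[q qA nq]|none] := pselect (exists2 q, q \in A & near i q u).
    rewrite (near_addable Hsep ncov qA nq) (_ : hit u = true); last first.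
      by apply/existsP; exists q.
    rewrite (bigD1 q)//= nq big1// => q' /andP[_ /negP ne].
    by apply/eqP; rewrite eqb0; apply/negP => nq'; apply/ne/eqP/(Hinj i _ _ u).
  rewrite big1// => q qA; apply/eqP; rewrite eqb0; apply/negP => nq.
  by apply: none; exists q.
apply: le_trans sumhit; apply: (@le_trans _ _ (2 * theta * beta *
    \sum_(q in A) #|near i q|%:R)).
  rewrite -[leRHS]mulrA ler_wpM2l ?mulr_ge0// mulr_sumr.
  by apply: ler_sum => q _; exact: Hkn.
rewrite -[leRHS]mul1r ler_wpM2r// sumr_ge0//.
Qed.

(** Among the separated sets of total weight below 1 take one of maximal size.
    If it left a copy uncovered, that copy would have an alive point, its weight
    being below 1; so some site could be added, and by averaging one of them
    keeps the total weight below 1, against maximality. *)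
Lemma hard_core_cover (R : realType) (G I Q : finType)
    (near kill : I -> Q -> pred G) (sep : rel G) (a : nat) (beta theta : R) :
  0 <= theta -> theta * a%:R <= 1 / 2 -> 2 * theta * beta <= 1 ->
  #|I|%:R * expR (- (theta * #|Q|%:R)) < 1 ->
  symmetric sep ->
  (forall i q, exists u, near i q u) ->
  (forall i q, #|kill i q|%:R <= beta * #|near i q|%:R) ->
  (forall i u, (#|[set q | kill i q u]%SET| <= a)%N) ->
  (forall i q q' u, near i q u -> near i q' u -> q = q') ->
  (forall i q u v, near i q u -> ~~ kill i q v -> sep u v) ->
  exists2 U : {set G},
    {in U &, forall u v, u != v -> sep u v} & forall i, covered near U i.
Proof.
move=> th0 tha thb HI ssym Hne Hkn Ha Hinj Hsep.
pose Phi U : R := \sum_i weight near kill theta U i.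
pose ok : pred {set G} := fun U =>
  [forall u in U, forall v in U, (u != v) ==> sep u v] && (Phi U < 1).
have ok0 : ok finset.set0.
  apply/andP; split; first by apply/forall_inP => u; rewrite inE.
  apply: le_lt_trans HI; rewrite mulr_natl -sumr_const; apply: ler_sum => i _.
  rewrite /weight; case: ifP => [_|_]; first exact: expR_ge0.
  suff -> : alive kill finset.set0 i = [set: Q]%SET by rewrite cardsT.
  by apply/setP => q; rewrite !inE; apply/forall_inP => u; rewrite inE.
case: (@arg_maxnP _ _ ok (fun U : {set G} => #|U|) ok0).
move=> U /andP[sepU PhiU] Umax.
exists U.
  move=> u v uU vU uv; move/forall_inP: sepU => /(_ u uU)/forall_inP/(_ v vU).
  by rewrite uv.
move=> i0; have [//|ncov] := boolP (covered near U i0); exfalso.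
set S := addable sep U.
have [w wS] : exists w, w \in S.
  have : alive kill U i0 != finset.set0.
    apply: contraTneq PhiU => al0; rewrite -leNgt /Phi (bigD1 i0)//=.
    rewrite {1}/weight (negbTE ncov) al0 cards0 mulr0 oppr0 expR0 lerDl.
    apply: sumr_ge0 => i _; rewrite /weight.
    by case: ifP => // _; apply: expR_ge0.
  case/set0Pn => q qal; have [u nu] := Hne i0 q; exists u.
  exact: (near_addable Hsep ncov qal nu).
have avg : \sum_(u in S) (Phi (u |: U)%SET - Phi U) <= 0.
  rewrite big_split /= sumrN sumr_const subr_le0 exchange_big /= -mulr_natl.
  rewrite /Phi mulr_sumr; apply: ler_sum => i _.
  exact: sum_weight_step Hkn Ha Hinj Hsep.
have [u uS Phiu] : exists2 u, u \in S & Phi (u |: U)%SET <= Phi U.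
  apply/exists_inP; apply: contraLR avg => /exists_inPn h; rewrite -ltNge.
  apply: (@lt_le_trans _ _ (Phi (w |: U)%SET - Phi U)).
    by rewrite subr_gt0 ltNge h.
  rewrite (bigD1 w)//= lerDl sumr_ge0// => v /andP[vS _].
  by rewrite subr_ge0 ltW// ltNge h.
move: uS; rewrite inE => /andP[uU /forall_inP sepu].
have := Umax (u |: U)%SET; rewrite cardsU1 uU /= ltnn => Hmax.
suff : false by [].
apply: Hmax; apply/andP; split; last exact: le_lt_trans Phiu PhiU.
apply/forall_inP => x; rewrite !inE => xU; apply/forall_inP => y.
rewrite !inE => yU; apply/implyP => xy.
case/orP: xU => [/eqP xu|xU]; case/orP: yU => [/eqP yu|yU].
- by rewrite xu yu eqxx in xy.
- by rewrite xu; apply: sepu.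
- by rewrite yu ssym; apply: sepu.
- by move/forall_inP: sepU => /(_ x xU)/forall_inP/(_ y yU); rewrite xy.
Qed.

(** * Euclidean norm and isometries *)

Definition dot (R : realType) (n : nat) (x y : 'rV[R]_n) : R :=
  \sum_(i < n) x 0 i * y 0 i.

Lemma dotC (R : realType) (n : nat) (x y : 'rV[R]_n) : dot x y = dot y x.
Proof. by apply: eq_bigr => i _; rewrite mulrC. Qed.

Lemma dotDl (R : realType) (n : nat) (x y z : 'rV[R]_n) :
  dot (x + y) z = dot x z + dot y z.
Proof. by rewrite -big_split; apply: eq_bigr => i _; rewrite mxE mulrDl. Qed.

Lemma dotZl (R : realType) (n : nat) (c : R) (x y : 'rV[R]_n) :
  dot (c *: x) y = c * dot x y.
Proof. by rewrite mulr_sumr; apply: eq_bigr => i _; rewrite mxE mulrA. Qed.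

Lemma dotNl (R : realType) (n : nat) (x y : 'rV[R]_n) : dot (- x) y = - dot x y.
Proof. by rewrite -scaleN1r dotZl mulN1r. Qed.

Lemma dotBl (R : realType) (n : nat) (x y z : 'rV[R]_n) :
  dot (x - y) z = dot x z - dot y z.
Proof. by rewrite dotDl dotNl. Qed.

Lemma dotBr (R : realType) (n : nat) (x y z : 'rV[R]_n) :
  dot x (y - z) = dot x y - dot x z.
Proof. by rewrite dotC dotBl !(dotC x). Qed.

Lemma dot_suml (R : realType) (n : nat) (I : finType) (F : I -> 'rV[R]_n) y :
  dot (\sum_i F i) y = \sum_i dot (F i) y.
Proof.
elim/big_rec2: _ => [|i a b _ <-]; last by rewrite dotDl.
by rewrite /dot big1// => i _; rewrite mxE mul0r.
Qed.

Lemma dot_ge0 (R : realType) (n : nat) (x : 'rV[R]_n) : 0 <= dot x x.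
Proof. by apply: sumr_ge0 => i _; rewrite -expr2 sqr_ge0. Qed.

Lemma dot_eq0 (R : realType) (n : nat) (x : 'rV[R]_n) : dot x x = 0 -> x = 0.
Proof.
move=> x0; apply/rowP => i; rewrite mxE; apply/eqP; rewrite -sqrf_eq0.
move/eqP: x0; rewrite psumr_eq0 => [|j _]; last by rewrite -expr2 sqr_ge0.
by move=> /allP/(_ i); rewrite mem_index_enum -expr2; apply.
Qed.

Definition enorm (R : realType) (n : nat) (x : 'rV[R]_n) : R :=
  Num.sqrt (dot x x).

Lemma eucl_distE (R : realType) (n : nat) (x y : 'rV[R]_n) :
  eucl_dist x y = enorm (x - y).
Proof.
by congr Num.sqrt; apply: eq_bigr => i _; rewrite !mxE expr2.
Qed.

Lemma enorm_ge0 (R : realType) (n : nat) (x : 'rV[R]_n) : 0 <= enorm x.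
Proof. exact: sqrtr_ge0. Qed.

Lemma sqr_enorm (R : realType) (n : nat) (x : 'rV[R]_n) : enorm x ^+ 2 = dot x x.
Proof. by rewrite sqr_sqrtr ?dot_ge0. Qed.

Lemma enormN (R : realType) (n : nat) (x : 'rV[R]_n) : enorm (- x) = enorm x.
Proof. by rewrite /enorm dotNl dotC dotNl opprK. Qed.

Lemma enormZ (R : realType) (n : nat) (c : R) (x : 'rV[R]_n) :
  enorm (c *: x) = `|c| * enorm x.
Proof.
by rewrite /enorm dotZl dotC dotZl mulrA -expr2 sqrtrM ?sqr_ge0// sqrtr_sqr.
Qed.

(** Expand the square of [enorm y *: x - enorm x *: y]. *)
Lemma cauchy_schwarz (R : realType) (n : nat) (x y : 'rV[R]_n) :
  dot x y <= enorm x * enorm y.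
Proof.
have [x0|xn0] := eqVneq (enorm x) 0.
  have : dot x x = 0 by rewrite -sqr_enorm x0 expr0n.
  by move=> /dot_eq0 ->; rewrite -(scale0r 0) dotZl mul0r mulr_ge0// enorm_ge0.
have [y0|yn0] := eqVneq (enorm y) 0.
  have : dot y y = 0 by rewrite -sqr_enorm y0 expr0n.
  move=> /dot_eq0 ->; rewrite -(scale0r 0) dotC dotZl mul0r.
  by rewrite mulr_ge0// enorm_ge0.
have xp : 0 < enorm x by rewrite lt_def xn0 enorm_ge0.
have yp : 0 < enorm y by rewrite lt_def yn0 enorm_ge0.
have := dot_ge0 (enorm y *: x - enorm x *: y).
rewrite dotBl !dotBr !dotZl !(dotC _ (_ *: _)) !dotZl -!sqr_enorm (dotC y x).
set a := enorm x in xp *; set b := enorm y in yp *; set d := dot x y => h.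
have ab : 0 < a * b by rewrite mulr_gt0.
have : 0 <= (a * b) * (a * b - d) by nra.
by rewrite pmulr_rge0// subr_ge0.
Qed.

Lemma enormD (R : realType) (n : nat) (x y : 'rV[R]_n) :
  enorm (x + y) <= enorm x + enorm y.
Proof.
rewrite -(@ler_pXn2r _ 2)// ?nnegrE ?addr_ge0 ?enorm_ge0//.
rewrite sqrrD !sqr_enorm dotDl !(dotC _ (x + y)) !dotDl (dotC y x).
have := cauchy_schwarz x y; lra.
Qed.

Lemma enorm_coord (R : realType) (n : nat) (x : 'rV[R]_n) i :
  `|x 0 i| <= enorm x.
Proof.
rewrite -sqrtr_sqr ler_wsqrtr// /dot (bigD1 i)//= expr2 lerDl sumr_ge0// => j _.
by rewrite -expr2 sqr_ge0.
Qed.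

Lemma enorm_le_coord (R : realType) (n : nat) (x : 'rV[R]_n) (c : R) :
  (forall i, `|x 0 i| <= c) -> enorm x <= n%:R * c.
Proof.
case: n x => [|n] x xc.
  by rewrite mul0r /enorm /dot big_ord0 sqrtr0.
have c0 : 0 <= c by apply: le_trans (xc 0).
rewrite -(@ler_pXn2r _ 2)// ?nnegrE ?mulr_ge0 ?enorm_ge0//.
rewrite sqr_enorm exprMn; apply: (@le_trans _ _ (n.+1%:R * c ^+ 2)).
  rewrite mulr_natl -[X in _ *+ X](card_ord n.+1) -sumr_const.
  apply: ler_sum => i _; rewrite -expr2 -real_normK ?num_real//.
  by rewrite ler_pXn2r// nnegrE.
by rewrite ler_wpM2r ?sqr_ge0// -natrX ler_nat expnS expn1 leq_pmulr.
Qed.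

Definition isometry (R : realType) (n : nat) (f : 'rV[R]_n -> 'rV[R]_n) : Prop :=
  forall x y, eucl_dist (f x) (f y) = eucl_dist x y.

(** [g x = f x - f 0] preserves norms and distances, hence scalar products, by
    polarization.  Then [g x] minus the combination of the [g e_i] with the
    coordinates of [x] is orthogonal to the range of [g] and so to itself. *)
Lemma isometry_affine (R : realType) (n : nat) (f : 'rV[R]_n -> 'rV[R]_n) :
  isometry f ->
  exists2 A : 'M[R]_n, forall x y, f x - f y = (x - y) *m A &
    forall i j, `|A i j| <= 1.
Proof.
move=> fi; have [g gE] : exists g, forall x, g x = f x - f 0 by eexists.
have gn x y : dot (g x - g y) (g x - g y) = dot (x - y) (x - y).
  by rewrite -!sqr_enorm !gE opprB addrA subrK -!eucl_distE fi.
have g0 : g 0 = 0 by rewrite gE subrr.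
have gg x : dot (g x) (g x) = dot x x by have := gn x 0; rewrite g0 !subr0.
have gd x y : dot (g x) (g y) = dot x y.
  by have := gn x y; rewrite !dotBl !dotBr !gg (dotC (g y)) (dotC y); lra.
pose A : 'M[R]_n := \matrix_(i, j) g (delta_mx 0 i) 0 j.
have rA i : row i A = g (delta_mx 0 i) by apply/rowP => j; rewrite !mxE.
have dd (x : 'rV[R]_n) i : dot x (delta_mx 0 i) = x 0 i.
  rewrite /dot (bigD1 i)//= !mxE !eqxx mulr1 big1 ?addr0// => j ji.
  by rewrite !mxE (negbTE ji) mulr0.
have xA (x : 'rV[R]_n) : x *m A = \sum_i x 0 i *: g (delta_mx 0 i).
  by rewrite mulmx_sum_row; apply: eq_bigr => i _; rewrite rA.
have gA x : g x = x *m A.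
  apply/eqP; rewrite -subr_eq0; apply/eqP/dot_eq0.
  have orth y : dot (g x - x *m A) (g y) = 0.
    rewrite dotBl gd xA dot_suml; apply/eqP; rewrite subr_eq0; apply/eqP.
    by apply: eq_bigr => i _; rewrite dotZl gd dotC dd.
  rewrite dotBr orth xA dotC dot_suml big1 ?subrr// => i _.
  by rewrite dotZl dotC -xA orth mulr0.
exists A.
  by move=> x y; rewrite mulmxBl -!gA !gE opprB addrA subrK.
move=> i j; apply: (@le_trans _ _ (enorm (g (delta_mx 0 i)))).
  by rewrite mxE; exact: enorm_coord.
by rewrite /enorm gg dd mxE !eqxx sqrtr1.
Qed.

(** * The torus and its grid *)

(** The images of [x] and [y] in the torus R^n / L Z^n are at distance less
    than [r]. *)
Definition tnear (R : realType) (L n : nat) (r : R) (x y : 'rV[R]_n) : Prop :=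
  exists z : 'rV[int]_n, enorm (x - y - L%:R *: map_mx intr z) < r.

Lemma dist_tnear (R : realType) (L n : nat) (r : R) (x y : 'rV[R]_n) :
  enorm (x - y) < r -> tnear L r x y.
Proof. by move=> xy; exists 0; rewrite map_mx0 scaler0 subr0. Qed.

Lemma tnear_sym (R : realType) (L n : nat) (r : R) (x y : 'rV[R]_n) :
  tnear L r x y -> tnear L r y x.
Proof.
move=> [z zr]; exists (- z); rewrite map_mxN scalerN -enormN.
by rewrite opprD opprK opprB.
Qed.

Lemma tnear_trans (R : realType) (L n : nat) (r s : R) (x y w : 'rV[R]_n) :
  tnear L r x y -> tnear L s y w -> tnear L (r + s) x w.
Proof.
move=> [z zr] [t ts]; exists (z + t); rewrite map_mxD scalerDr.
apply: le_lt_trans (ltrD zr ts); apply: le_trans (enormD _ _).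
rewrite le_eqVlt; apply/orP; left; apply/eqP; congr enorm.
by apply/rowP => i; rewrite !mxE; ring.
Qed.

Lemma tnear_le (R : realType) (L n : nat) (r s : R) (x y : 'rV[R]_n) :
  r <= s -> tnear L r x y -> tnear L s x y.
Proof. by move=> rs [z zr]; exists z; apply: lt_le_trans rs. Qed.

Lemma lattice_norm (R : realType) (L n : nat) (z : 'rV[int]_n) :
  z != 0 -> (L%:R : R) <= enorm (L%:R *: map_mx intr z : 'rV[R]_n).
Proof.
move=> /rV0Pn[i zi]; apply: le_trans (enorm_coord _ i); rewrite !mxE normrM.
rewrite ger0_norm// -[leLHS]mulr1 ler_wpM2l// -intr_norm ler1z.
by rewrite -gtz0_ge1 normr_gt0.
Qed.

(** For points that are close compared with the period, the torus distance is
    the Euclidean one. *)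
Lemma tnear_dist (R : realType) (L n : nat) (r : R) (x y : 'rV[R]_n) :
  enorm (x - y) <= L%:R - r -> tnear L r x y -> enorm (x - y) < r.
Proof.
move=> xyL [z]; have [->|/(lattice_norm R L)] := eqVneq z 0.
  by rewrite map_mx0 scaler0 subr0.
set t := _ *: _ => Lt xyt.
have := enormD (x - y) (- (x - y - t)).
by rewrite enormN opprB addrC subrK => ?; lra.
Qed.

Definition zres (N : nat) (v : int) : 'I_N.+1 := inord `|(v %% N.+1)%Z|%N.

Lemma zresE (N : nat) (v : int) : (zres N v : int) = (v %% N.+1)%Z.
Proof.
have h0 : (0 <= v %% N.+1)%Z by rewrite modz_ge0.
have h1 : ((v %% N.+1)%Z < N.+1 :> int) by rewrite ltz_pmod.
by rewrite /zres inordK ?gez0_abs//; lia.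
Qed.

Lemma zres_eq (N : nat) (v w : int) :
  zres N v = zres N w -> exists z : int, v = w + N.+1%:Z * z.
Proof.
move=> /(congr1 (fun i : 'I_N.+1 => (i : int))); rewrite !zresE => vw.
exists ((v %/ N.+1)%Z - (w %/ N.+1)%Z).
by rewrite {1}(divz_eq v N.+1) {1}(divz_eq w N.+1) vw; ring.
Qed.

Lemma zres_ord (N : nat) (u : 'I_N.+1) (z : int) :
  zres N ((u : int) + N.+1%:Z * z) = u.
Proof.
apply/val_inj/eqP; rewrite -eqz_nat zresE.
rewrite mulrC addrC modzMDl modz_small//.
by rewrite ltz_nat ltn_ord.
Qed.

(** The sites are the points of (1/D) Z^n modulo L Z^n, that is, the integer
    vectors modulo [N.+1 = L * D]. *)
Definition grid_point (R : realType) (D n : nat) (v : 'rV[int]_n) : 'rV[R]_n :=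
  D%:R^-1 *: map_mx intr v.

Definition site (R : realType) (D N n : nat) (u : {ffun 'I_n -> 'I_N.+1}) :=
  grid_point R D (\row_i (u i : int)).

Definition reduce (N n : nat) (v : 'rV[int]_n) : {ffun 'I_n -> 'I_N.+1} :=
  [ffun i => zres N (v 0 i)].

Lemma tnear_reduce (R : realType) (L D N n : nat) (r : R) (x : 'rV[R]_n) v :
  (0 < D)%N -> N.+1 = (L * D)%N ->
  enorm (x - grid_point R D v) < r -> tnear L r x (site R D (reduce N v)).
Proof.
move=> D0 NLD xv; exists (\row_i divz (v 0 i) N.+1).
rewrite -addrA -opprD; congr (enorm (x - _) < r) : xv.
have Dn0 : D%:R != 0 :> R by rewrite pnatr_eq0 -lt0n.
apply/rowP => i; have e : (v 0 i)%:~R = L%:R * D%:R * (divz (v 0 i) N.+1)%:~R +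
    (modz (v 0 i) N.+1)%:~R :> R.
  by rewrite {1}(divz_eq (v 0 i) N.+1) rmorphD rmorphM /= mulrC -natrM -NLD.
by rewrite !mxE ffunE zresE e; field.
Qed.

Lemma tnear_site (R : realType) (L D N n : nat) (r : R) (x : 'rV[R]_n) u :
  (0 < D)%N -> N.+1 = (L * D)%N -> tnear L r x (site R D u) ->
  exists2 v, reduce N v = u & enorm (x - grid_point R D v) < r.
Proof.
move=> D0 NLD [z zr]; exists (\row_i ((u i : int) + N.+1%:Z * z 0 i)).
  by apply/ffunP => i; rewrite ffunE mxE zres_ord.
have Dn0 : D%:R != 0 :> R by rewrite pnatr_eq0 -lt0n.
have NE : (N.+1%:Z)%:~R = L%:R * D%:R :> R by rewrite -natrM -NLD.
congr (enorm _ < r) : zr; apply/rowP => i; rewrite !mxE.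
by rewrite rmorphD rmorphM /= NE; field.
Qed.

Lemma reduce_inj (R : realType) (L D N n : nat) (r : R) (x : 'rV[R]_n) v w :
  (0 < D)%N -> N.+1 = (L * D)%N -> 2 * r <= L%:R ->
  enorm (x - grid_point R D v) < r -> enorm (x - grid_point R D w) < r ->
  reduce N v = reduce N w -> v = w.
Proof.
move=> D0 NLD rL xv xw vw; apply/rowP => i.
have [z vwz] : exists z : int, v 0 i = w 0 i + N.+1%:Z * z.
  by apply: zres_eq; move/ffunP: vw => /(_ i); rewrite !ffunE.
have Dp : 0 < D%:R :> R by rewrite ltr0n.
have Dn0 : D%:R != 0 :> R by rewrite gt_eqF.
have : `|L%:R * z%:~R| < L%:R :> R.
  apply: lt_le_trans rL.
  have -> : L%:R * z%:~R =
      (x - grid_point R D w) 0 i - (x - grid_point R D v) 0 i.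
    have NE : (N.+1%:Z)%:~R = L%:R * D%:R :> R by rewrite -natrM -NLD.
    by rewrite !mxE vwz rmorphD rmorphM /= NE; field.
  have := enorm_coord (x - grid_point R D w) i.
  have := enorm_coord (x - grid_point R D v) i.
  have := ler_normB ((x - grid_point R D w) 0 i) ((x - grid_point R D v) 0 i).
  move=> *; lra.
rewrite normrM ger0_norm//.
have L0 : 0 < L%:R :> R by rewrite ltr0n; case: (L) NLD.
rewrite -[X in _ < X]mulr1 ltr_pM2l// -intr_norm ltrz1 => z1.
have -> : v 0 i = w 0 i by rewrite vwz; lia.
by [].
Qed.

Lemma floor_dist (R : realType) (x : R) : `|x - (Num.floor x)%:~R| <= 1.
Proof.
have /andP[h1] := floor_itv x; rewrite rmorphD /= => h2.
by rewrite ger0_norm; lra.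
Qed.

Definition grid_floor (R : realType) (D n : nat) (x : 'rV[R]_n) : 'rV[int]_n :=
  \row_i Num.floor (D%:R * x 0 i).

Lemma grid_floor_coord (R : realType) (D n : nat) (x : 'rV[R]_n) i :
  (0 < D)%N -> `|(x - grid_point R D (grid_floor D x)) 0 i| <= D%:R^-1.
Proof.
move=> D0; have Dp : 0 < D%:R :> R by rewrite ltr0n.
have Dn0 : D%:R != 0 :> R by rewrite gt_eqF.
have := floor_dist (D%:R * x 0 i); rewrite !mxE => h.
have -> : x 0 i - D%:R^-1 * (Num.floor (D%:R * x 0 i))%:~R =
  D%:R^-1 * (D%:R * x 0 i - (Num.floor (D%:R * x 0 i))%:~R) by field.
by rewrite normrM gtr0_norm ?invr_gt0// ler_piMr// invr_ge0.
Qed.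

Definition sites_near (R : realType) (L D N n : nat) (r : R) (x : 'rV[R]_n) :
    pred {ffun 'I_n -> 'I_N.+1} := fun u => `[< tnear L r x (site R D u) >].

Lemma sites_near_neq0 (R : realType) (L D N n : nat) (r : R) (x : 'rV[R]_n) :
  (0 < D)%N -> N.+1 = (L * D)%N -> n%:R / D%:R < r ->
  exists u, sites_near L D (N := N) r x u.
Proof.
move=> D0 NLD Dr; exists (reduce N (grid_floor D x)); apply/asboolP.
apply: tnear_reduce => //; apply: le_lt_trans Dr.
by apply: enorm_le_coord => i; apply: grid_floor_coord.
Qed.

(** Contraction of the grid by the factor [s / p] around [k].  Together with a
    digit vector [d] in base [s] a grid vector [v] gives the integers
    [s * (v - k) + d]; they are divided by [p], and the quotient is kept.  The
    pairs (vector, digits in base [s]) and (quotient, remainder in base [p])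
    determine each other, so counting them compares the numbers of grid points
    of a ball and of its contraction by the rational factor [s / p]. *)
Definition contract (n s p : nat) (k v d : 'rV[int]_n) : 'rV[int]_n :=
  \row_i (k 0 i + divz (s%:Z * (v 0 i - k 0 i) + d 0 i) p).

Lemma contract_near (R : realType) (D n s p : nat) (r r' : R) (x : 'rV[R]_n)
    (v d : 'rV[int]_n) :
  (0 < D)%N -> (0 < s)%N -> (s <= p)%N -> (forall i, 0 <= d 0 i < s%:Z) ->
  s%:R / p%:R * r + 2 * n%:R / D%:R <= r' ->
  enorm (x - grid_point R D v) < r ->
  enorm (x - grid_point R D (contract s p (grid_floor D x) v d)) < r'.
Proof.
move=> D0 s0 sp dI rr' xv; set k := grid_floor D x.
have xk i : `|(x - grid_point R D k) 0 i| <= D%:R^-1 by apply: grid_floor_coord.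
clearbody k; have Dp : 0 < D%:R :> R by rewrite ltr0n.
have Dn0 : D%:R != 0 :> R by rewrite gt_eqF.
have p0 : 0 < p%:R :> R by rewrite ltr0n (leq_trans s0).
have pn0 : p%:R != 0 :> R by rewrite gt_eqF.
have s0R : 0 < s%:R :> R by rewrite ltr0n.
have spR : s%:R / p%:R <= 1 :> R by rewrite ler_pdivrMr// mul1r ler_nat.
have sp0 : 0 < s%:R / p%:R :> R by rewrite divr_gt0.
apply: lt_le_trans rr'.
set w := contract _ _ _ _ _.
(* [e] collects the rounding of [x] to [k] and that of the division by [p]. *)
pose e : 'rV[R]_n :=
  x - grid_point R D w - (s%:R / p%:R) *: (x - grid_point R D v).
have -> : x - grid_point R D w = (s%:R / p%:R) *: (x - grid_point R D v) + e.
  by rewrite /e addrCA subrr addr0.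
apply: le_lt_trans (enormD _ _) _; rewrite enormZ gtr0_norm//.
apply: ltr_leD; first by rewrite ltr_pM2l.
rewrite [leRHS]mulrAC [leRHS]mulrC; apply: enorm_le_coord => i.
have := ltz_pmod (s%:Z * (v 0 i - k 0 i) + d 0 i) (_ : 0 < p%:Z).
have := modz_ge0 (s%:Z * (v 0 i - k 0 i) + d 0 i) (_ : p%:Z != 0).
have p1 : (0 < p)%N by apply: leq_trans sp.
have pz0 : p%:Z != 0 by lia.
have pz1 : 0 < p%:Z by lia.
set c := (modz _ _) => /(_ pz0) c0 /(_ pz1) c1.
have cE := divz_eq (s%:Z * (v 0 i - k 0 i) + d 0 i) p; rewrite -/c in cE.
set m := divz _ _ in cE.
have mE : m%:~R =
    (s%:R * ((v 0 i)%:~R - (k 0 i)%:~R) + (d 0 i)%:~R - c%:~R) / p%:R :> R.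
  clearbody c m; have /(congr1 (fun t : int => t%:~R : R)) := cE.
  rewrite !rmorphD !rmorphM /= rmorphB /= => h.
  by apply: (mulIf pn0); rewrite divfK// h addrK.
have -> : e 0 i = (1 - s%:R / p%:R) * (x - grid_point R D k) 0 i +
    (c%:~R - (d 0 i)%:~R) / p%:R / D%:R.
  by rewrite /e /w !mxE -/m rmorphD /= mE; field; rewrite Dn0.
apply: le_trans (ler_normD _ _) _.
have -> : 2 * D%:R^-1 = D%:R^-1 + D%:R^-1 :> R by rewrite mulr2n mulrDl mul1r.
apply: lerD.
  rewrite normrM; apply: le_trans (xk i); rewrite ler_piMl// ger0_norm; lra.
rewrite normrM [X in _ * X]gtr0_norm ?invr_gt0// ler_piMl ?invr_ge0 ?ltW//.
rewrite normrM [X in _ * X]gtr0_norm ?invr_gt0// ltr_pdivrMr// mul1r.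
rewrite -rmorphB /= -intr_norm -[p%:R]/(p%:Z%:~R) ltr_int.
have := dI i; lia.
Qed.

Lemma contract_inj (n s p : nat) (k v v' d d' : 'rV[int]_n) :
  (forall i, 0 <= d 0 i < s%:Z) -> (forall i, 0 <= d' 0 i < s%:Z) ->
  contract s p k v d = contract s p k v' d' ->
  (forall i, modz (s%:Z * (v 0 i - k 0 i) + d 0 i) p =
             modz (s%:Z * (v' 0 i - k 0 i) + d' 0 i) p) ->
  v = v' /\ d = d'.
Proof.
move=> dI dI' /rowP ww cc.
suff h i : v 0 i = v' 0 i /\ d 0 i = d' 0 i.
  by split; apply/rowP => i; case: (h i).
have := cc i; have := ww i; rewrite !mxE => /addrI wi ci.
have := divz_eq (s%:Z * (v 0 i - k 0 i) + d 0 i) p.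
rewrite wi ci -divz_eq => e; have := dI i; have := dI' i => d'i di.
have vv : v 0 i = v' 0 i.
  have : s%:Z * (v 0 i - v' 0 i) = d' 0 i - d 0 i by lia.
  by move: (v 0 i) (v' 0 i) (d 0 i) (d' 0 i) d'i di => a b c c' *; nia.
by split=> //; move: e; rewrite vv => /addrI.
Qed.

(** A substitute for the scaling of volumes: the number of sites in a ball of
    radius [r] is at most [(p / s) ^ n] times the number in a ball of radius
    [s / p * r], up to the rounding error [2 n / D] in the radius.  The map sends
    a site and base-[s] digits to the contracted site and base-[p] remainders;
    it is injective because a ball of diameter at most [L] embeds in the
    torus. *)
Lemma sites_near_card (R : realType) (L D N n s p : nat) (r r' : R)
    (x : 'rV[R]_n) :
  (0 < D)%N -> N.+1 = (L * D)%N -> (0 < s)%N -> (s <= p)%N ->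
  s%:R / p%:R * r + 2 * n%:R / D%:R <= r' -> 2 * r' <= L%:R ->
  (#|sites_near L D (N := N) r x| * s ^ n <=
   #|sites_near L D (N := N) r' x| * p ^ n)%N.
Proof.
case: s => // s; case: p => // p D0 NLD s0 sp rr' rL.
pose G := {ffun 'I_n -> 'I_N.+1}.
have [rep repP] : exists rep : G -> 'rV[int]_n, forall u, sites_near L D r x u ->
    reduce N (rep u) = u /\ enorm (x - grid_point R D (rep u)) < r.
  have /choice[rep repP] : forall u : G, exists v, sites_near L D r x u ->
      reduce N v = u /\ enorm (x - grid_point R D v) < r.
    move=> u; have [|//] := boolP (sites_near L D r x u); last by exists 0.
    by move=> /asboolP/(tnear_site D0 NLD)[v *]; exists v.
  by exists rep.
pose k := grid_floor D x.
pose dv (d : {ffun 'I_n -> 'I_s.+1}) : 'rV[int]_n := \row_i (d i : int).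
have dvI d i : 0 <= dv d 0 i < s.+1%:Z by rewrite mxE ltz_nat ltn_ord andbT.
pose w (t : G * {ffun 'I_n -> 'I_s.+1}) :=
  contract s.+1 p.+1 k (rep t.1) (dv t.2).
pose c (t : G * {ffun 'I_n -> 'I_s.+1}) : {ffun 'I_n -> 'I_p.+1} :=
  [ffun i => zres p (s.+1%:Z * (rep t.1 0 i - k 0 i) + dv t.2 0 i)].
pose A := finset.setX (finset (sites_near L D (N := N) r x))
  [set: {ffun 'I_n -> 'I_s.+1}]%SET.
pose B := finset.setX (finset (sites_near L D (N := N) r' x))
  [set: {ffun 'I_n -> 'I_p.+1}]%SET.
have wn t : t \in A -> enorm (x - grid_point R D (w t)) < r'.
  rewrite !inE andbT => /repP[_ h].
  by apply: contract_near rr' h => //; exact: dvI.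
have -> : (#|sites_near L D (N := N) r x| * s.+1 ^ n = #|A|)%N.
  by rewrite /A cardsX cardsE cardsT card_ffun !card_ord.
have -> : (#|sites_near L D (N := N) r' x| * p.+1 ^ n = #|B|)%N.
  by rewrite /B cardsX cardsE cardsT card_ffun !card_ord.
rewrite -(@card_in_imset _ _ (fun t => (reduce N (w t), c t)) A).
  apply: subset_leq_card; apply/fintype.subsetP => _ /imsetP[t tA ->].
  rewrite !inE andbT; apply/asboolP; apply: tnear_reduce => //; exact: wn.
move=> [u d] [u' d'] tA tA' [ww cc].
have {}ww := reduce_inj D0 NLD rL (wn _ tA) (wn _ tA') ww.
have [vv dd] : rep u = rep u' /\ dv d = dv d'.
  apply: (contract_inj _ _ ww) => [i|i|i]; try exact: dvI.
  move/ffunP: cc => /(_ i); rewrite !ffunE.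
  by move=> /(congr1 (fun i : 'I_p.+1 => (i : int))); rewrite !zresE.
move: tA tA'; rewrite !inE !andbT /= => /repP[uu _] /repP[uu' _].
rewrite -uu -uu' vv; congr pair; apply/ffunP => i; apply: val_inj.
by move/rowP: dd => /(_ i); rewrite !mxE => -[].
Qed.

(** * A finite net of isometries *)

Lemma zres_floor (R : realType) (L H N : nat) (y y' : R) :
  (0 < H)%N -> N.+1 = (L * H)%N ->
  zres N (Num.floor (H%:R * y)) = zres N (Num.floor (H%:R * y')) ->
  exists z : int, `|y - y' - L%:R * z%:~R| < H%:R^-1.
Proof.
move=> H0 NLH /zres_eq[z zE]; exists z.
have Hp : 0 < H%:R :> R by rewrite ltr0n.
have Hn0 : H%:R != 0 :> R by rewrite gt_eqF.
have NE : (N.+1%:Z)%:~R = L%:R * H%:R :> R by rewrite -natrM -NLH.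
have := congr1 (fun t : int => t%:~R : R) zE.
rewrite rmorphD rmorphM /= NE => {}zE.
have -> : y - y' - L%:R * z%:~R = ((H%:R * y - (Num.floor (H%:R * y))%:~R) -
    (H%:R * y' - (Num.floor (H%:R * y'))%:~R)) / H%:R.
  by rewrite zE; field.
have /andP[] := floor_itv (H%:R * y); have /andP[] := floor_itv (H%:R * y').
rewrite !rmorphD /= => a b c d.
rewrite normrM [X in _ * X]gtr0_norm ?invr_gt0// gtr_pMl ?invr_gt0//.
rewrite ltr_norml; lra.
Qed.

(** Rounding is done modulo [L] for all coordinates alike; the entries of a
    linear isometry are at most 1 in absolute value, so for them nothing is
    lost. *)
Lemma zres_floor_small (R : realType) (L H N : nat) (y y' : R) :
  (0 < H)%N -> (2 < L)%N -> N.+1 = (L * H)%N -> `|y| <= 1 -> `|y'| <= 1 ->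
  zres N (Num.floor (H%:R * y)) = zres N (Num.floor (H%:R * y')) ->
  `|y - y'| < H%:R^-1.
Proof.
move=> H0 L2 NLH y1 y'1 /(zres_floor H0 NLH)[z].
have [->|z0] := eqVneq z 0; first by rewrite mulr0 subr0.
have H1 : H%:R^-1 <= 1 :> R by rewrite invf_le1 ?ltr0n// ler1n.
have z1 : 1 <= `|z%:~R| :> R by rewrite -intr_norm ler1z; lia.
have L3 : 3 <= L%:R :> R by rewrite ler_nat.
have : L%:R <= `|L%:R * z%:~R| :> R.
  by rewrite normrM ger0_norm// ler_peMr.
set t := L%:R * _ => Lt yt.
have h : t = y - y' - (y - y' - t) by ring.
have := ler_normB (y - y') (y - y' - t); rewrite -h.
have := ler_normB y y'; move=> *; lra.
Qed.

(** The class of an isometry consists of the rounded coordinates of the image of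
    [q0] and of the rounded entries of the linear part.  Each class that occurs
    is represented by an isometry belonging to it, rather than by the rounded
    affine map, so that separation and diameter are preserved exactly. *)
Lemma isometry_net (R : realType) (n L H N : nat) (q0 : 'rV[R]_n) :
  (0 < H)%N -> (2 < L)%N -> N.+1 = (L * H)%N ->
  exists (I : finType) (F : I -> 'rV[R]_n -> 'rV[R]_n),
    [/\ #|I| = (N.+1 ^ (n * n.+1))%N, forall i, isometry (F i) &
     forall f, isometry f -> exists i, forall q rho eps,
       enorm (q - q0) <= rho -> n%:R * (H%:R^-1 * (1 + n%:R * rho)) < eps ->
       tnear L eps (f q) (F i q)].
Proof.
move=> H0 L2 NLH.
pose I : finType := ({ffun 'I_n -> 'I_N.+1} * {ffun 'I_n * 'I_n -> 'I_N.+1})%type.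
pose aff (f : 'rV[R]_n -> 'rV[R]_n) (A : 'M[R]_n) :=
  (forall x y, f x - f y = (x - y) *m A) /\ forall i j, `|A i j| <= 1.
pose code (f : 'rV[R]_n -> 'rV[R]_n) (A : 'M[R]_n) : I :=
  ([ffun j => zres N (Num.floor (H%:R * f q0 0 j))],
   [ffun ij => zres N (Num.floor (H%:R * A ij.1 ij.2))]).
pose fits i f := isometry f /\ exists2 A, aff f A & code f A = i.
have /choice[F FP] : forall i : I, exists f, isometry f /\
    ((exists g, fits i g) -> fits i f).
  move=> i; have [[g gi]|no] := pselect (exists g, fits i g).
    by exists g; split=> //; case: gi.
  by exists id; split=> // [[g gi]]; exfalso; apply: no; exists g.
exists I, F; split => [|i|f fi].
- by rewrite card_prod !card_ffun card_prod !card_ord -expnD mulnS.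
- by case: (FP i).
have [A fA A1] := isometry_affine fi; exists (code f A).
have [_ /(_ (ex_intro _ f _))[]] := FP (code f A).
  by split=> //; exists A.
set g := F _ => gi [B [gB B1] [/ffunP e1 /ffunP e2]] q rho eps qrho.
have /choice[z zP] : forall j, exists z : int,
    `|f q0 0 j - g q0 0 j - L%:R * z%:~R| < H%:R^-1.
  by move=> j; apply: (zres_floor H0 NLH); have := e1 j; rewrite !ffunE.
have AB i j : `|A i j - B i j| < H%:R^-1.
  by apply: (zres_floor_small H0 L2 NLH) => //; have := e2 (i, j); rewrite !ffunE.
move=> epsP; exists (\row_j z j); apply: le_lt_trans epsP.
apply: enorm_le_coord => j.
have -> : f q - g q - L%:R *: map_mx intr (\row_j z j) =
    (f q0 - g q0 - L%:R *: map_mx intr (\row_j z j)) + (q - q0) *m (A - B).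
  by rewrite mulmxBr -fA -gB; apply/rowP => k; rewrite !mxE; ring.
rewrite mxE mulrDr mulr1; apply: le_trans (ler_normD _ _) _; apply: lerD.
  by have := ltW (zP j); rewrite !mxE.
rewrite mxE; apply: le_trans (ler_norm_sum _ _ _) _.
rewrite mulrCA -[X in X%:R * _](card_ord n) mulr_natl -sumr_const.
apply: ler_sum => i _; rewrite normrM mulrC ler_pM//.
  by have := ltW (AB i j); rewrite !mxE.
exact: le_trans (enorm_coord _ i) qrho.
Qed.

(** * The coloring *)

(** [(1 + 1 / n) ^ n] is at most [expR 1], and [expR (1 / 2) <= 2]. *)
Lemma exp_one_plus_inv (R : realType) (n : nat) :
  (0 < n)%N -> (n.+1%:R / n%:R) ^+ n <= 4 :> R.
Proof.
move=> n0; have np : 0 < n%:R :> R by rewrite ltr0n.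
have e1 : (n.+1%:R / n%:R : R) <= expR (n%:R^-1).
  have -> : n.+1%:R / n%:R = 1 + n%:R^-1 :> R.
    by rewrite -natr1 mulrDl mul1r divff ?gt_eqF.
  exact: expR_ge1Dx.
apply: (@le_trans _ _ (expR (n%:R^-1) ^+ n)).
  by rewrite lerXn2r ?nnegrE ?expR_ge0// divr_ge0.
rewrite -expRM_natl divff ?gt_eqF//.
have -> : 1 = 1 / 2 + 1 / 2 :> R by lra.
have := @expR_le1D2x R (1 / 2); rewrite expRD => h.
have h2 : expR (1 / 2) <= 2 :> R by apply: le_trans (h _ _) _; lra.
have := expR_ge0 (1 / 2 : R); nra.
Qed.

(** The radii 5/2 and 1/2 - 2 eps have the ratio [5 * n.+1 / n] for
    [eps = 1 / (4 (n + 1))], and the factor [((n + 1) / n) ^ n] is bounded. *)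
Lemma expansion_ratio (R : realType) (n k k' : nat) : (0 < n)%N ->
  (k * n ^ n <= k' * (5 * n.+1) ^ n)%N -> k%:R <= 4 * 5 ^+ n * k'%:R :> R.
Proof.
move=> n0 kk; have np : 0 < n%:R ^+ n :> R by rewrite exprn_gt0// ltr0n.
rewrite -(ler_pM2r np); move: kk; rewrite -(ler_nat R) !natrM !natrX natrM => kk.
apply: (le_trans kk); have := exp_one_plus_inv R n0.
rewrite expr_div_n ler_pdivrMr// exprMn => h.
have k0 : 0 <= k'%:R :> R by [].
have f0 : 0 <= 5 ^+ n :> R by rewrite exprn_ge0.
rewrite [leLHS]mulrC [leRHS]mulrAC ler_wpM2r// -mulrA mulrCA ler_wpM2l//.
Qed.

(** The left-hand side is the number of classes in [isometry_net] for the
    rounding precision [H = 20 n^3 L] and the period [L]. *)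
Lemma code_count_le (R : realType) (n L : nat) (RK : R) : (0 < n)%N -> 2 < RK ->
  L%:R <= RK + 5 ->
  ((L * (20 * n ^ 3 * L)) ^ (n * n.+1))%:R <= RK ^+ (28 * n ^ 3).
Proof.
move=> n0 RK2 LR.
have RK1 : 1 <= RK by lra.
have RK0 : 0 <= RK by lra.
apply: (@le_trans _ _ ((RK ^+ (14 * n)) ^+ (n * n.+1))); last first.
  rewrite -exprM; apply: ler_weXn2l => //; nia.
rewrite natrX; apply: lerXn2r; rewrite ?nnegrE ?exprn_ge0//.
have L3 : L%:R <= RK ^+ 3.
  by apply: (le_trans LR); rewrite !exprS expr0 mulr1; nra.
have c20 : 20 <= RK ^+ 5.
  apply: (@le_trans _ _ (2 ^+ 5)); first by rewrite !exprS expr0; lra.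
  by apply: lerXn2r; rewrite ?nnegrE ?ltW//; lra.
have nR : n%:R <= RK ^+ n.
  apply: (@le_trans _ _ (2 ^+ n)).
    by rewrite -natrX ler_nat ltnW// ltn_expl.
  by apply: lerXn2r; rewrite ?nnegrE ?ltW//; lra.
apply: (@le_trans _ _ (RK ^+ 3 * (RK ^+ 5 * RK ^+ (n * 3) * RK ^+ 3))).
  have -> : (L * (20 * n ^ 3 * L))%:R = L%:R * (20 * n%:R ^+ 3 * L%:R) :> R.
    by rewrite natrM natrM natrM natrX.
  have n3 : n%:R ^+ 3 <= RK ^+ (n * 3).
    by rewrite exprM; apply: lerXn2r; rewrite ?nnegrE ?exprn_ge0.
  by do 3![apply: ler_pM; rewrite ?mulr_ge0 ?exprn_ge0//].
by rewrite -!exprD; apply: ler_weXn2l => //; lia.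
Qed.

(** The constant is [232 = 8 * 29]: the potential is run with
    [theta = 1 / (8 M)], where [M] is the maximum of [5 ^ n] and [CK], so that
    [theta * |Q|] exceeds [28 n^3 ln RK], the logarithm of the bound on the
    number of classes. *)
Lemma red_ball_coloring (R : realType) (n : nat) (RK : R) (CK : nat)
    (Q : finType) (pt : Q -> 'rV[R]_n) :
  (0 < n)%N -> 2 < RK ->
  (forall p q, p != q -> 1 <= enorm (pt p - pt q)) ->
  (forall p q, enorm (pt p - pt q) <= RK - 1) ->
  (forall q,
    (#|[set p | (p != q) && (enorm (pt p - pt q) < 5)%R]%SET| <= CK)%N) ->
  232 * n%:R ^+ 6 * ln RK * Num.max (5 ^+ n) CK%:R <= #|Q|%:R ->
  exists2 red : 'rV[R]_n -> bool,
    forall x y, red x -> red y -> enorm (x - y) <> 1 &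
    forall f, isometry f -> exists q, red (f (pt q)).
Proof.
move=> n0 RK2 sep1 diamK degK sizeK.
pose M : R := Num.max (5 ^+ n) CK%:R.
have M5 : 5 ^+ n <= M by rewrite /M le_max lexx.
have MC : CK%:R <= M by rewrite /M le_max lexx orbT.
have M1 : 1 <= M by apply: le_trans M5; rewrite exprn_ege1// ler1n.
have M0 : 0 < M by rewrite (lt_le_trans _ M1).
have lnR : 0 < ln RK by rewrite ln_gt0//; lra.
have nR : 1 <= n%:R :> R by rewrite ler1n.
have Q0 : (0 < #|Q|)%N.
  rewrite -(ltr_nat R); apply: lt_le_trans sizeK.
  have np : 0 < n%:R :> R by rewrite ltr0n.
  by rewrite !mulr_gt0// ?exprn_gt0.
have [q0 _] : exists q0 : Q, q0 \in Q by apply/card_gt0P.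
(* The margin 4 over RK lets torus distances below 5 between points of a copy
   be Euclidean ones. *)
pose L := (Num.truncn RK + 5)%N.
have [L1 L2] : L%:R <= RK + 5 /\ RK + 4 <= L%:R.
  have /andP[] := @truncn_itv R RK (ltac:(lra)).
  by rewrite -natr1 /L natrD => *; split; lra.
pose D := (8 * n * n.+1)%N; pose H := (20 * n ^ 3 * L)%N.
have D0 : (0 < D)%N by rewrite /D !muln_gt0 n0.
have L3 : (2 < L)%N by apply: leq_trans (leq_addl _ _).
have L0 : (0 < L)%N by apply: ltn_trans L3.
have H0 : (0 < H)%N by rewrite /H !muln_gt0 !n0 L0.
have [N NLD] : exists N, N.+1 = (L * D)%N.
  by exists (L * D).-1; rewrite prednK// muln_gt0 D0 L0.
have [N' NLH] : exists N, N.+1 = (L * H)%N.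
  by exists (L * H).-1; rewrite prednK// muln_gt0 H0 L0.
have [I [F [cardI Fiso Fnet]]] := isometry_net (pt q0) H0 L3 NLH.
pose eps : R := (4 * (n%:R + 1))^-1.
have epsE : eps * (4 * (n%:R + 1)) = 1 by rewrite /eps mulVf// gt_eqF//; lra.
have eps0 : 0 < eps by rewrite invr_gt0; lra.
have epsn : eps <= 1 / 8.
  have : 0 <= eps * (n%:R - 1) by rewrite mulr_ge0 ?subr_ge0// ltW.
  by move: epsE; rewrite mulrBr mulr1 !mulrDr => *; lra.
have DE : D%:R = 8 * n%:R * (n%:R + 1) :> R by rewrite /D !natrM -[n.+1%:R]natr1.
have nD : 2 * n%:R / D%:R = eps.
  by rewrite DE /eps; field; apply/andP; split; rewrite gt_eqF//; lra.
pose near i q := sites_near L D (N := N) (1 / 2 - eps) (F i (pt q)).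
pose kill i q := sites_near L D (N := N) (5 / 2) (F i (pt q)).
pose sep : rel {ffun 'I_n -> 'I_N.+1} :=
  fun u v => ~~ `[< tnear L 2 (site R D u) (site R D v) >].
have FE i p q : enorm (F i (pt p) - F i (pt q)) = enorm (pt p - pt q).
  by rewrite -!eucl_distE Fiso.
have [U sepU covU] : exists2 U : {set {ffun 'I_n -> 'I_N.+1}},
    {in U &, forall u v, u != v -> sep u v} & forall i, covered near U i.
  apply: (@hard_core_cover R _ I Q near kill sep CK.+1 (4 * 5 ^+ n) (8 * M)^-1).
  - by rewrite invr_ge0; lra.
  - by rewrite mulrC ler_pdivrMr -?[CK.+1%:R]natr1; lra.
  - rewrite mulrAC ler_pdivrMr; lra.
  - rewrite expRN -[_^-1]mul1r mulrA mulr1 ltr_pdivrMr ?expR_gt0//.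
    rewrite mul1r cardI NLH.
    apply: (le_lt_trans (code_count_le n0 RK2 L1)).
    rewrite -[X in X ^+ _](lnK (x := RK)) ?posrE//; last by lra.
    rewrite -expRM_natl ltr_expR natrM natrX.
    have h : 28 * n%:R ^+ 3 * ln RK < 29 * n%:R ^+ 6 * ln RK.
      rewrite ltr_pM2r//; apply: (@lt_le_trans _ _ (29 * n%:R ^+ 3)).
        by rewrite ltr_pM2r ?exprn_gt0//; lra.
      by rewrite ler_pM2l// ler_weXn2l.
    apply: (lt_le_trans h); rewrite [leRHS]mulrC ler_pdivlMr; last by lra.
    by apply: le_trans sizeK; rewrite -/M; lra.
  - move=> u v; rewrite /sep; congr (~~ _).
    by apply/asboolP/asboolP; exact: tnear_sym.
  - move=> i q; apply: sites_near_neq0 => //.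
    have : n%:R / D%:R = eps / 2 by rewrite -nD; lra.
    by move=> ->; lra.
  - move=> i q; apply: expansion_ratio => //; apply: sites_near_card => //.
    + by apply: leq_trans (leqnSn n) _; rewrite leq_pmull.
    (* [nD] says that rounding on the grid costs exactly [eps] in the radius. *)
    + rewrite nD natrM -[n.+1%:R]natr1.
      have -> : n%:R / (5 * (n%:R + 1)) * (5 / 2) = 1 / 2 - 2 * eps.
        by rewrite /eps; field; rewrite gt_eqF//; lra.
      lra.
    + lra.
  - move=> i u; have [[q qu]|none] := pselect (exists q, kill i q u); last first.
      rewrite (_ : [set q | kill i q u]%SET = finset.set0) ?cards0//.
      by apply/setP => q; rewrite !inE; apply/negP => qu; apply: none; exists q.
    apply: (@leq_trans
        #|q |: [set p | (p != q) && (enorm (pt p - pt q) < 5)%R]%SET|%SET).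
      apply: subset_leq_card; apply/fintype.subsetP => p; rewrite !inE => pu.
      have [//|/= pq] := eqVneq p q; rewrite -(FE i).
      apply: (@tnear_dist _ L); first by rewrite FE; have := diamK p q; lra.
      have {}qu : tnear L (5 / 2) (F i (pt q)) (site R D u) by apply/asboolP.
      by apply: tnear_le (tnear_trans pu (tnear_sym qu)); lra.
    rewrite cardsU1; apply: leq_trans (leq_add (leq_b1 _) (degK q)) _.
    by rewrite add1n.
  - move=> i q q' u /asboolP nq /asboolP nq'; apply/eqP/negPn/negP => qq'.
    have := sep1 _ _ qq'; rewrite leNgt => /negP; apply; rewrite -(FE i).
    apply: (@tnear_dist _ L); first by rewrite FE; have := diamK q q'; lra.
    apply: tnear_le (tnear_trans nq (tnear_sym nq')); lra.
  - move=> i q u v /asboolP nu; apply: contra => /asboolP uv; apply/asboolP.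
    apply: tnear_le (tnear_trans nu uv); lra.
pose red x := `[< exists2 u, u \in U & tnear L (1 / 2) x (site R D u) >].
exists red.
- move=> x y /asboolP[u uU xu] /asboolP[v vU yv] xy1.
  have xy : tnear L 1 x y -> False.
    by move=> /tnear_dist h; have := h (ltac:(lra)); rewrite xy1 ltxx.
  have [uv|uv] := eqVneq u v.
    apply: xy; have -> : 1 = 1 / 2 + 1 / 2 :> R by lra.
    by rewrite uv in xu; apply: tnear_trans (tnear_sym yv).
  have /negP := sepU u v uU vU uv; apply; apply/asboolP.
  (* The distance of [x] and [y] is 1 and not less, so the slack comes from the
     strict inequality for [x]. *)
  case: xu => z zu; set t := enorm _ in zu.
  pose r := (t + 1 / 2) / 2.
  have xu : tnear L r x (site R D u) by exists z; rewrite -/t /r; lra.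
  have xy' : tnear L (3 / 2 - r) x y by apply: dist_tnear; rewrite xy1 /r; lra.
  have -> : 2 = r + (3 / 2 - r) + 1 / 2 :> R by lra.
  by apply: tnear_trans yv; apply: tnear_trans xy'; apply: tnear_sym.
- move=> f fi; have [i fiP] := Fnet f fi.
  have /exists_inP[u uU /existsP[q /asboolP qu]] := covU i.
  exists q; apply/asboolP; exists u => //.
  have -> : 1 / 2 = eps + (1 / 2 - eps) by ring.
  apply: tnear_trans qu; apply: (fiP _ (RK - 1)) => //.
  have HE : H%:R = 20 * n%:R ^+ 3 * L%:R :> R by rewrite /H natrM natrM natrX.
  have Hp : 0 < H%:R :> R by rewrite ltr0n.
  rewrite mulrCA mulrC ltr_pdivrMr//.
  rewrite -(ltr_pM2r (_ : 0 < 4 * (n%:R + 1))); last by lra.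
  rewrite [ltRHS]mulrAC epsE mul1r HE.
  set a := n%:R; have a1 : 1 <= a by [].
  have a3 : a ^+ 3 = a * a * a by rewrite !exprS expr0 mulr1 mulrA.
  have la : 1 + a * (RK - 1) <= 2 * (a * L%:R) by nra.
  have la2 : 4 * (a + 1) <= 8 * a by lra.
  apply: (@le_lt_trans _ _ (a * (2 * (a * L%:R)) * (8 * a))).
    by rewrite ler_pM ?mulr_ge0//; nra.
  rewrite a3; have : 0 < a * a * a * L%:R by rewrite !mulr_gt0; lra.
  lra.
Qed.

(** * The theorem *)

Lemma counting_le_card (R : realType) (T : choiceType) (S : set T) (m : nat)
    (Q : finType) (A : {set Q}) (pt : Q -> T) :
  injective pt -> (forall p, p \in A -> S (pt p)) ->
  (counting S <= (m%:R : R)%:E)%E -> (#|A| <= m)%N.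
Proof.
move=> ptI AS; rewrite /counting; case: asboolP => [finS|_]; last by [].
rewrite lee_fin ler_nat; apply: leq_trans.
rewrite cardE -(size_map pt); apply: uniq_leq_size.
  by rewrite map_inj_uniq ?enum_uniq.
by move=> x /mapP[p]; rewrite mem_enum => /AS Sp ->; rewrite in_fset_set// inE.
Qed.

(** An infinite set has finite subsets of every size. *)
Lemma counting_ge_fset (R : realType) (T : choiceType) (S : set T) (c : R) :
  (c%:E <= counting S)%E ->
  exists2 K0 : {fset T}, (forall x, x \in K0 -> S x) & c <= #|{: K0}|%:R.
Proof.
rewrite /counting; case: asboolP => [finS|infS].
  rewrite lee_fin => cS; exists (fset_set S); last by rewrite -cardfE.
  by move=> x; rewrite in_fset_set// inE.
move=> _; have [K0 K0S cK0] := infinite_set_fset (Num.truncn c).+1 infS.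
exists K0; first exact: K0S.
rewrite -cardfE; apply: (@le_trans _ _ (Num.truncn c).+1%:R).
  exact/ltW/truncnS_gt.
by rewrite ler_nat.
Qed.

Lemma enorm_first (R : realType) (n : nat) :
  (0 < n)%N -> enorm (\row_(j < n) (j == 0 :> nat)%:R : 'rV[R]_n) = 1.
Proof.
case: n => // n _; rewrite /enorm /dot big_ord_recl big1 => [|i _].
  by rewrite !mxE mulr1 addr0 sqrtr1.
by rewrite !mxE mul0r.
Qed.

Theorem theorem1p1 (R : realType) :
  exists2 C : R, 0 < C &
  forall (n : nat) (RK : R) (K : set 'rV[R]_n) (CK : nat),
    (0 < n)%N ->
    2 < RK ->
    t_separated 1 K ->
    (diameter K <= (RK - 1)%:E)%E ->
    (forall q, K q ->
       (counting [set p | [/\ K p, p <> q & (eucl_dist p q < 5)%R]]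
          <= (CK%:R : R)%:E)%E) ->
    ((C * n%:R ^+ 6 * ln RK * Num.max (5 ^+ n) CK%:R)%:E <= counting K)%E ->
    ~ arrows (ell R n 2) K.
Proof.
exists 232 => // n RK K CK n0 RK2 Ksep Kdiam Kdeg /counting_ge_fset[K0 K0K cK0].
have [|||red red1 redK] := red_ball_coloring (CK := CK)
  (pt := val : K0 -> 'rV[R]_n) n0 RK2 _ _ _ cK0.
- move=> p q pq; rewrite -eucl_distE; apply: Ksep; try exact/K0K/valP.
  by move=> /val_inj e; rewrite e eqxx in pq.
- move=> p q; rewrite -eucl_distE -lee_fin; apply: le_trans Kdiam.
  apply: ereal_sup_ubound; exists (val p); first exact/K0K/valP.
  by exists (val q) => //; exact/K0K/valP.
- move=> q; apply: (counting_le_card val_inj _ (Kdeg _ (K0K _ (valP q)))) => p.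
  rewrite inE => /andP[pq pq5]; split; [exact/K0K/valP| |by rewrite eucl_distE].
  by move=> /val_inj e; rewrite e eqxx in pq.
move=> /(_ red)[[T [f fi ->] Tred]|[T [f fi ->] Tblue]]; last first.
  have [q] := redK f fi; rewrite Tblue//.
  by exists (val q) => //; exact/K0K/valP.
pose e : 'rV[R]_n := \row_(j < n) (j == 0 :> nat)%:R.
have red_pt i : (i < 2)%N -> red (f (i%:R *: e)).
  by move=> i2; apply: Tred; exists (i%:R *: e) => //; exists i.
apply: (red1 _ _ (red_pt 1%N isT) (red_pt 0%N isT)).
by rewrite -eucl_distE fi eucl_distE scale0r scale1r subr0 enorm_first.
Qed.
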